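(* In the game BPFSI (binary probability forecasting with side information, described in the context), let $\pi$ be any prior density on $\mathbb{R}^d$ supporting a neighborhood of the origin. Then by the Bayesian logistic strategy with prior $\pi$ Skeptic can weakly force the conditional event $$E_1 \ \Rightarrow\ \lim_{n\to\infty} \mathcal{V}_n^{-1}\mathcal{S}_n = 0 .$$ That is, the capital process $\mathcal{K}_n^\pi$ is never negative, and $\limsup_n \mathcal{K}_n^\pi(\xi)=\infty$ for every path $\xi\in E_1$ for which $\mathcal{V}_n^{-1}\mathcal{S}_n\not\to 0$.
   Context: Game BPFSI. Fix $d\ge 1$. Put $\mathcal{K}_0=1$, $\mathcal{S}_0=0\in\mathbb{R}^d$, $\mathcal{V}_0=0\in\mathbb{R}^{d\times d}$. For $n=1,2,\dots$: Forecaster announces $p_n\in(0,1)$ and a column vector $c_n\in\mathbb{R}^d$; Skeptic announces $M_n\in\mathbb{R}$; Reality announces $x_n\in\{0,1\}$; then $\mathcal{K}_n=\mathcal{K}_{n-1}+M_n(x_n-p_n)$, $\mathcal{S}_n=\mathcal{S}_{n-1}+c_n(x_n-p_n)$, $\mathcal{V}_n=\mathcal{V}_{n-1}+c_nc_n'\,p_n(1-p_n)$, where $'$ denotes transpose. Skeptic must keep $\mathcal{K}_n$ non-negative. A path is an infinite sequence $\xi=p_1c_1x_1p_2c_2x_2\dots$ with $p_n\in(0,1)$, $c_n\in\mathbb{R}^d$, $x_n\in\{0,1\}$; an event is a set of paths. A strategy of Skeptic determines his move on day $n$ from $p_1c_1x_1\dots p_{n-1}c_{n-1}x_{n-1}p_nc_n$.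 Weak forcing: by a strategy with capital process $\mathcal{K}_n$, Skeptic can weakly force the conditional event $E_1\Rightarrow E_2$ if $\mathcal{K}_n$ is never negative and $\limsup_n\mathcal{K}_n(\xi)=\infty$ for all $\xi\in E_1\cap E_2^C$. Regularity event: with $\lambda_{\max,n},\lambda_{\min,n}$ the maximum and minimum eigenvalues of $\mathcal{V}_n$, $E_1$ is the set of paths such that $\lim_n\lambda_{\min,n}=\infty$, $\limsup_n\lambda_{\max,n}/\lambda_{\min,n}<\infty$, and $\{c_1,c_2,\dots\}$ is bounded. (On $E_1$, $\mathcal{V}_n$ is invertible for all large $n$.) Bayesian logistic strategy: for $\theta\in\mathbb{R}^d$ let $$\mathcal{K}_n^\theta=\frac{e^{\theta'\sum_{i=1}^n c_ix_i}}{\prod_{i=1}^n\bigl(1+p_i(e^{\theta'c_i}-1)\bigr)} .$$ This is the capital process of the strategy betting $M_n=\mathcal{K}_{n-1}\nu_n$, $\nu_n=\frac{\hat p_n-p_n}{p_n(1-p_n)}$, where $\log\frac{\hat p_n}{1-\hat p_n}=\log\frac{p_n}{1-p_n}+\theta'c_n$. For a prior probability density $\pi$ on $\mathbb{R}^d$, the Bayesian logistic strategy with prior $\pi$ is the strategy with capital process $\mathcal{K}_n^\pi=\int_{\mathbb{R}^d}\mathcal{K}_n^\theta\,\pi(\theta)\,d\theta$. A prior $\pi$ supports a neighborhood of the origin if $\pi$ is positive in a neighborhood of the origin. *)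

(* Defs.v *)
From HB Require Import structures.
From mathcomp Require Import all_boot all_order all_algebra.
From mathcomp Require Import all_classical all_reals all_analysis.
Set Implicit Arguments.
Unset Strict Implicit.
Unset Printing Implicit Defensive.
Import Order.TTheory GRing.Theory Num.Theory.
Import numFieldNormedType.Exports.
Local Open Scope classical_set_scope.
Local Open Scope ring_scope.

(* The measurable structure on column vectors is the product sigma-algebra,
   i.e. the one generated by the coordinate maps, in the same way as the
   structure on n.-tuple T; for real vectors it is the Borel sigma-algebra. *)
Section measurable_cV.
Context {R : realType} {n : nat}.

Definition cV_coord (i : 'I_n) (v : 'cV[R]_n) : measurableTypeR R := v i ord0.

Let cV_set0 : g_sigma_preimage cV_coord set0.
Proof. exact: sigma_algebra0. Qed.

Let cV_setC A : g_sigma_preimage cV_coord A -> g_sigma_preimage cV_coord (~` A).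
Proof. exact: sigma_algebraC. Qed.

Let cV_bigcup (F : (set 'cV[R]_n)^nat) :
  (forall i, g_sigma_preimage cV_coord (F i)) ->
  g_sigma_preimage cV_coord (\bigcup_i F i).
Proof. exact: sigma_algebra_bigcup. Qed.

HB.instance Definition _ := @isMeasurable.Build default_measure_display
  'cV[R]_n (g_sigma_preimage cV_coord) cV_set0 cV_setC cV_bigcup.

End measurable_cV.

Lemma measurable_cV_coord (R : realType) (n : nat) (i : 'I_n) :
  measurable_fun [set: 'cV[R]_n] (cV_coord i).
Proof.
move=> _ Y mY; rewrite setTI; apply: sub_sigma_algebra => /=.
rewrite -bigcup_seq/=; exists i => /=; first by rewrite mem_index_enum.
by exists Y => //; rewrite setTI.
Qed.

Lemma measurable_fun_cVP d (T : measurableType d) (R : realType) (n : nat)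
    (f : T -> 'cV[R]_n) :
  (forall i, measurable_fun [set: T] (cV_coord i \o f)) ->
  measurable_fun [set: T] f.
Proof.
move=> mf _ A mA; rewrite setTI.
have : g_sigma_preimage (fun i => cV_coord i \o f) `<=` measurable.
  apply: smallest_sub; first exact: sigma_algebra_measurable.
  move=> B; rewrite -bigcup_seq/= => -[i _ [C mC <-]].
  exact: mf.
apply; rewrite g_sigma_preimage_comp.
by exists A => //; rewrite setTI.
Qed.

(* (x, v) |-> (x, v_0, ..., v_(n-1))' *)
Definition cV_cons (R : realType) (n : nat)
  (z : measurableTypeR R * 'cV[R]_n) : 'cV[R]_n.+1 :=
  \col_i (if unlift ord0 i is Some j then z.2 j ord0 else z.1).

Lemma measurable_cV_cons (R : realType) (n : nat) :
  measurable_fun [set: measurableTypeR R * 'cV[R]_n] (@cV_cons R n).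
Proof.
apply: measurable_fun_cVP => i.
case: (unliftP ord0 i) => [j ->|->].
- rewrite (_ : _ \o _ = cV_coord j \o snd); last first.
    by apply/funext => z; rewrite /= /cV_coord mxE liftK.
  by apply: measurableT_comp => //; exact: measurable_cV_coord.
- rewrite (_ : _ \o _ = fst); first exact: measurable_fst.
  by apply/funext => z; rewrite /= /cV_coord mxE unlift_none.
Qed.

(* Lebesgue measure on R^n: the n-fold product of the Lebesgue measure on R,
   transported to column vectors. *)
Section lebesgue_cV.
Context {R : realType}.

Section step.
Context {n : nat} (mu : {measure set 'cV[R]_n -> \bar R}).
Local Open Scope ereal_scope.

Definition lebesgue_cV_step : set 'cV[R]_n.+1 -> \bar R :=
  pushforward (@lebesgue_measure R \x^ mu) (@cV_cons R n).

Let step0 : lebesgue_cV_step set0 = 0.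
Proof. by rewrite /lebesgue_cV_step /pushforward preimage_set0 measure0. Qed.

Let step_ge0 A : 0 <= lebesgue_cV_step A.
Proof. by rewrite /lebesgue_cV_step /pushforward measure_ge0. Qed.

Let step_sigma_additive : semi_sigma_additive lebesgue_cV_step.
Proof.
move=> F mF tF mUF; rewrite /lebesgue_cV_step /pushforward preimage_bigcup.
apply: measure_semi_sigma_additive.
- by move=> k; rewrite -[X in measurable X]setTI; exact: measurable_cV_cons.
- apply/trivIsetP => /= i j _ _ ij; rewrite -preimage_setI.
  by move/trivIsetP : tF => /(_ _ _ _ _ ij) ->//; rewrite preimage_set0.
- rewrite -preimage_bigcup -[X in measurable X]setTI.
  exact: measurable_cV_cons.
Qed.

HB.instance Definition _ := isMeasure.Build _ _ _
  lebesgue_cV_step step0 step_ge0 step_sigma_additive.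

End step.

Fixpoint lebesgue_cV (n : nat) : {measure set 'cV[R]_n -> \bar R} :=
  match n with
  | 0 => \d_(0 : 'cV[R]_0)
  | n'.+1 => lebesgue_cV_step (lebesgue_cV n')
  end.

End lebesgue_cV.

Lemma lebesgue_cV_box (R : realType) (n : nat)
    (A : 'I_n -> set (measurableTypeR R)) :
  (forall i, measurable (A i)) ->
  lebesgue_cV n [set v | forall i, A i (v i ord0)] =
  (\prod_(i < n) @lebesgue_measure R (A i))%E.
Proof.
elim: n A => [|n ih] A mA.
  by rewrite big_ord0 /= diracE mem_set// => -[].
have mB : measurable [set v : 'cV[R]_n | forall i, A (lift ord0 i) (v i ord0)].
  rewrite (_ : [set _ | _] =
    \bigcap_(i in [set: 'I_n]) (setT `&` cV_coord i @^-1` A (lift ord0 i))).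
    by apply: fin_bigcap_measurable => // i _; exact: measurable_cV_coord.
  by apply/seteqP; split=> [v h i _|v h i]; [split=> //; exact: h|have [] := h i I].
rewrite big_ord_recl -[X in (_ * X)%E]ih; last by move=> i; exact: mA.
rewrite /= /lebesgue_cV_step /pushforward -product_measure2E//.
congr (product_measure2 _ _ _); apply/seteqP; split=> -[a v] /=.
  move=> h; split=> [|i]; first by have := h ord0; rewrite mxE unlift_none.
  by have := h (lift ord0 i); rewrite mxE liftK.
move=> [ha hv] i; rewrite mxE.
by case: (unliftP ord0 i) => [j ->|->].
Qed.

Section BPFSI.
Context {R : realType} {d : nat}.

(* Days are numbered from 0: forecast n, side n and outcome n are the moves
   p_(n+1), c_(n+1) and x_(n+1) when days are counted from 1. *)
Record game_path := GamePath {
  forecast : nat -> R;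
  side : nat -> 'cV[R]_d;
  outcome : nat -> bool;
  forecast_itv : forall n, 0 < forecast n < 1
}.

Definition history (xi : game_path) (n : nat) : seq (R * 'cV[R]_d * bool) :=
  mkseq (fun i => (forecast xi i, side xi i, outcome xi i)) n.

(* Skeptic's bet as a function of the completed days and of the current
   forecast and side information. *)
Definition strategy := seq (R * 'cV[R]_d * bool) -> R -> 'cV[R]_d -> R.

Definition bet (P : strategy) (xi : game_path) (n : nat) : R :=
  P (history xi n) (forecast xi n) (side xi n).

Fixpoint capital (P : strategy) (xi : game_path) (n : nat) : R :=
  match n with
  | 0 => 1
  | m.+1 => capital P xi m + bet P xi m * ((outcome xi m)%:R - forecast xi m)
  end.

Fixpoint S_ (xi : game_path) (n : nat) : 'cV[R]_d :=
  match n with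
  | 0 => 0
  | m.+1 => S_ xi m + ((outcome xi m)%:R - forecast xi m) *: side xi m
  end.

Fixpoint V_ (xi : game_path) (n : nat) : 'M[R]_d :=
  match n with
  | 0 => 0
  | m.+1 => V_ xi m +
      (forecast xi m * (1 - forecast xi m)) *: (side xi m *m (side xi m)^T)
  end.

Definition weakly_forces (P : strategy) (E1 E2 : set game_path) : Prop :=
  (forall xi n, 0 <= capital P xi n) /\
  (forall xi, (E1 `&` ~` E2) xi ->
     limn_esup (fun n => (capital P xi n)%:E) = +oo%E).

(* Only used for real symmetric matrices of size at least 1, for which the set
   of eigenvalues is finite and nonempty, so that sup and inf are the maximum
   and the minimum. *)
Definition lambda_max (A : 'M[R]_d) : R := sup [set a | eigenvalue A a].
Definition lambda_min (A : 'M[R]_d) : R := inf [set a | eigenvalue A a].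

Definition regular_event : set game_path := [set xi |
  [/\ lambda_min (V_ xi n) @[n --> \oo] --> +oo,
      (limn_esup (fun n => (lambda_max (V_ xi n) / lambda_min (V_ xi n))%:E)
         < +oo)%E
    & bounded_set (range (side xi))]].

(* invmx A is A itself when A is singular; on regular paths V_ xi n is
   invertible for all large n, so this does not affect the limit. *)
Definition consistency_event : set game_path := [set xi |
  (invmx (V_ xi n) *m S_ xi n) @[n --> \oo] --> (0 : 'cV[R]_d)].

Definition dot (u v : 'cV[R]_d) : R := (u^T *m v) ord0 ord0.

Definition logistic_capital (theta : 'cV[R]_d) (xi : game_path) (n : nat) : R :=
  expR (dot theta (\sum_(i < n) (outcome xi i)%:R *: side xi i)) /
  \prod_(i < n) (1 + forecast xi i * (expR (dot theta (side xi i)) - 1)).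

Definition prior_density (prior : 'cV[R]_d -> R) : Prop :=
  [/\ measurable_fun setT prior, (forall theta, 0 <= prior theta)
    & (\int[lebesgue_cV d]_theta (prior theta)%:E = 1)%E].

Definition supports_nbhs_origin (prior : 'cV[R]_d -> R) : Prop :=
  \forall theta \near (0 : 'cV[R]_d), 0 < prior theta.

Definition bayesian_capital (prior : 'cV[R]_d -> R) (xi : game_path) (n : nat) :
    \bar R :=
  (\int[lebesgue_cV d]_theta (logistic_capital theta xi n * prior theta)%:E)%E.

(* On histories with forecasts in ]0, 1[ a strategy is determined by its
   capital process: bet P xi n is the capital after outcome n = 1 minus the
   capital after outcome n = 0. *)
Definition is_bayesian_logistic (prior : 'cV[R]_d -> R) (P : strategy) : Prop :=
  forall xi n, (capital P xi n)%:E = bayesian_capital prior xi n.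

End BPFSI.
Arguments game_path : clear implicits.
Arguments strategy : clear implicits.

(* Main.v *)
Require Import Defs.
From HB Require Import structures.
From mathcomp Require Import all_boot all_order all_algebra.
From mathcomp Require Import all_classical all_reals all_analysis measurable_realfun.
From mathcomp Require Import ring lra.
Set Implicit Arguments.
Unset Strict Implicit.
Unset Printing Implicit Defensive.
Import Order.TTheory GRing.Theory Num.Theory.
Import numFieldNormedType.Exports.
Local Open Scope classical_set_scope.
Local Open Scope ring_scope.

(** Under the tilted forecast with parameter theta, day n multiplies Skeptic's
capital by a likelihood ratio whose mean under the actual forecast is 1
([likelihood_fair]). Mixing over the prior preserves this identity, so the
mixture is the capital of the strategy which bets the difference between its two
possible next values ([bayesian_strategyP]); it is nonnegative as an integral of
nonnegative functions.

For the divergence, the elementary inequality [e^z <= 1 + z + 2 z^2] for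
[|z| <= 1/2] replaces the expansion of the logarithm of the capital: when
[|theta' c_i| <= 1/2] for all i,

  [K_n^theta >= exp (theta' S_n - 2 theta' V_n theta)]

([logistic_capital_lower]). Put [b = V_n^-1 S_n], so that the exponent is
[theta' V_n b - 2 theta' V_n theta]. On days with [|b| >= eps], at the point
theta = t b / |b| for a small t this is at least a multiple of [t^2] times
the smallest eigenvalue lambda of [V_n]. Because the condition number of [V_n] is
bounded, the bound survives a perturbation of theta whose size is a fixed fraction
of t ([form_gap]). The directions [b / |b|] of infinitely many such days have a
cluster point w ([unit_cluster]), so one fixed cube around [t w] has the lower
bound on infinitely many days ([logistic_capital_diverges]). For small t this cube
lies in the neighbourhood where the prior is positive, hence it carries a
positive prior mass m ([prior_mass_gt0]), and on these days the mixture is at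
least [m exp (const t^2 lambda)], where lambda tends to infinity.

The spectral input is that the extreme eigenvalues of a symmetric matrix bound its
quadratic form ([lambda_min_form] and [lambda_max_form]), which is derived from
Cauchy-Schwarz alone ([rayleigh_min]). Vector norms are maximum norms
throughout; they are compared with the Euclidean form [dot v v] when the eigenvalue
bounds are used, at the cost of a factor d. *)

(** * Quadratic forms and extreme eigenvalues *)

Section dot_product.
Context {R : realType} {d : nat}.
Implicit Types (u v w : 'cV[R]_d) (A : 'M[R]_d) (a : R).

Lemma dotE u v : dot u v = \sum_(i < d) u i ord0 * v i ord0.
Proof. by rewrite /dot mxE; apply: eq_bigr => i _; rewrite mxE. Qed.

Lemma dotC u v : dot u v = dot v u.
Proof. by rewrite !dotE; apply: eq_bigr => i _; rewrite mulrC. Qed.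

Lemma dotDr u v w : dot u (v + w) = dot u v + dot u w.
Proof. by rewrite /dot mulmxDr mxE. Qed.

Lemma dotDl u v w : dot (u + v) w = dot u w + dot v w.
Proof. by rewrite dotC dotDr !(dotC w). Qed.

Lemma dotZr a u v : dot u (a *: v) = a * dot u v.
Proof. by rewrite /dot -scalemxAr mxE. Qed.

Lemma dotZl a u v : dot (a *: u) v = a * dot u v.
Proof. by rewrite dotC dotZr dotC. Qed.

Lemma dot0r u : dot u 0 = 0.
Proof. by rewrite -(scale0r 0) dotZr mul0r. Qed.

Lemma dotNr u v : dot u (- v) = - dot u v.
Proof. by rewrite -scaleN1r dotZr mulN1r. Qed.

Lemma dot_mulmxC A u v : A^T = A -> dot u (A *m v) = dot v (A *m u).
Proof. by move=> sA; rewrite [RHS]dotC /dot mulmxA trmx_mul sA. Qed.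

Lemma dot_ge0 u : 0 <= dot u u.
Proof. by rewrite dotE; apply: sumr_ge0 => i _; rewrite -expr2 sqr_ge0. Qed.

Lemma dot_gt0 u : u != 0 -> 0 < dot u u.
Proof.
move=> u0; rewrite lt_neqAle dot_ge0 andbT eq_sym; apply: contra u0.
rewrite dotE psumr_eq0 => [/allP u0|i _]; last by rewrite -expr2 sqr_ge0.
apply/eqP/matrixP => i j; rewrite ord1 mxE.
by have := u0 i (mem_index_enum _); rewrite /= mulf_eq0 orbb => /eqP.
Qed.

(** Finiteness of the Rayleigh quotient, with a crude constant: the sum of the
moduli of the entries, plus 1 to make it positive. *)
Lemma form_le_dot A : exists2 C : R, 0 < C &
  forall v, dot v (A *m v) <= C * dot v v.
Proof.
exists (1 + \sum_(i < d) \sum_(j < d) `|A i j|).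
  by rewrite ltr_pwDl ?ltr01//; do 2! apply: sumr_ge0 => ? _.
move=> v; rewrite mulrDl mul1r -[leLHS]add0r lerD ?dot_ge0// [leLHS]dotE mulr_suml.
apply: ler_sum => i _; rewrite mxE mulr_sumr mulr_suml.
have sqr_le k : v k ord0 ^+ 2 <= dot v v.
  rewrite dotE (bigD1 k)//= -expr2 lerDl.
  by apply: sumr_ge0 => l _; rewrite -expr2 sqr_ge0.
apply: ler_sum => j _.
have -> : v i ord0 * (A i j * v j ord0) = A i j * (v i ord0 * v j ord0) by ring.
apply: le_trans (ler_norm _) _; rewrite normrM ler_wpM2l//.
have := sqr_le i; have := sqr_le j; rewrite ler_norml => hj hi.
by apply/andP; split; nra.
Qed.

(** The binary quadratic form [(s, t) |-> s^2 a + 2 s t b + t^2 c], which is the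
value of the form of A at [s u + t v], has no sign change, so its discriminant is
nonpositive. *)
Lemma psd_cauchy_schwarz A u v : A^T = A ->
  (forall w, 0 <= dot w (A *m w)) ->
  dot u (A *m v) ^+ 2 <= dot u (A *m u) * dot v (A *m v).
Proof.
move=> sA A0.
set b := dot u (A *m v); set a := dot u (A *m u); set c := dot v (A *m v).
have quad s t : 0 <= s ^+ 2 * a + 2 * s * t * b + t ^+ 2 * c.
  have := A0 (s *: u + t *: v).
  rewrite mulmxDr !dotDr !dotDl -!scalemxAr !dotZr !dotZl.
  rewrite (dot_mulmxC v u sA) -/a -/b -/c.
  by congr (0 <= _); ring.
have a0 : 0 <= a by exact: A0.
have c0 : 0 <= c by exact: A0.
(* The point (c, -b) gives c (a c - b^2) >= 0; if c = 0, the other one gives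
   b = 0. *)
have := quad c (- b); have := quad b (- (a + 1)).
have [->|cn0] := eqVneq c 0; first by move=> *; nra.
have cgt0 : 0 < c by rewrite lt_neqAle eq_sym cn0.
move=> _ h; have {}h : 0 <= c * (a * c - b ^+ 2) by nra.
by rewrite pmulr_rge0// subr_ge0 in h.
Qed.

Lemma non_eigenvalue_unitmx A a : ~~ eigenvalue A a -> A - a%:M \in unitmx.
Proof. by rewrite /eigenvalue negbK kermx_eq0 row_free_unit. Qed.

Lemma eigenvalue_form A a : eigenvalue A a -> A^T = A ->
  exists2 v, v != 0 & dot v (A *m v) = a * dot v v.
Proof.
move=> /eigenvalueP[w wA w0] sA; exists w^T.
  by apply: contra w0 => /eqP/(congr1 trmx); rewrite trmxK trmx0 => ->.
by rewrite -{1}sA -trmx_mul wA linearZ/= dotZr.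
Qed.

(** The infimum m of the Rayleigh quotient is an eigenvalue: otherwise
[A - m] is an invertible nonnegative form, and Cauchy-Schwarz applied to [v]
and [(A - m)^-1 v] bounds it below by a positive multiple of the norm, so that
m could be increased. *)
Lemma rayleigh_min A v0 : A^T = A -> v0 != 0 ->
  exists2 m, eigenvalue A m & forall v, m * dot v v <= dot v (A *m v).
Proof.
move=> sA v00.
have [C C0 AC] := form_le_dot (- A).
pose Q := [set dot v (A *m v) / dot v v | v in [set v | v != 0]].
have Qlb : lbound Q (- C).
  move=> _ [v /= v_neq0 <-]; rewrite ler_pdivlMr ?dot_gt0//.
  by have := AC v; rewrite mulNmx dotNr; lra.
have Q0 : Q !=set0 by exists (dot v0 (A *m v0) / dot v0 v0), v0.
have infQ v : inf Q * dot v v <= dot v (A *m v).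
  have [->|v_neq0] := eqVneq v 0; first by rewrite mulmx0 !dot0r mulr0.
  rewrite -ler_pdivlMr ?dot_gt0//; apply: ge_inf; first by exists (- C).
  by exists v.
exists (inf Q) => //; apply: contrapT => /negP /non_eigenvalue_unitmx.
set B := A - _ => Bunit.
have sB : B^T = B by rewrite /B linearB /= sA tr_scalar_mx.
have dotB u v : dot u (B *m v) = dot u (A *m v) - inf Q * dot u v.
  by rewrite mulmxBl dotDr dotNr mul_scalar_mx dotZr.
have B0 v : 0 <= dot v (B *m v) by rewrite dotB subr_ge0.
have [K K0 BK] := form_le_dot (invmx B).
have inf_up : inf Q + K^-1 <= inf Q.
  apply: lb_le_inf => // _ [v /= v_neq0 <-].
  rewrite ler_pdivlMr ?dot_gt0// mulrDl -lerBrDl -dotB.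
  have vv := dot_gt0 v_neq0.
  have := psd_cauchy_schwarz (invmx B *m v) v sB B0.
  rewrite (dot_mulmxC (invmx B *m v) v sB) mulmxA mulmxV// mul1mx.
  rewrite (dotC (_ *m v) v) expr2 => cs.
  have : dot v v * dot v v <= K * dot v v * dot v (B *m v).
    by apply: le_trans cs _; rewrite ler_wpM2r.
  rewrite -mulrA [X in _ <= X]mulrCA ler_pM2l// => h.
  by rewrite ler_pdivrMl.
by move: inf_up; rewrite gerDl leNgt invr_gt0 K0.
Qed.

Lemma lambda_min_form A v : A^T = A ->
  lambda_min A * dot v v <= dot v (A *m v).
Proof.
move=> sA; have [->|v0] := eqVneq v 0; first by rewrite mulmx0 !dot0r mulr0.
have [m mA mlb] := rayleigh_min sA v0.
apply: le_trans (mlb v); apply: ler_wpM2r; first exact: dot_ge0.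
apply: ge_inf => //; exists m => a /= /eigenvalue_form/(_ sA)[w w0 wa].
by rewrite -(@ler_pM2r _ (dot w w)) ?dot_gt0// -wa.
Qed.

(** The largest eigenvalue of A is the opposite of the smallest one of [- A]. *)
Lemma lambda_max_form A v : A^T = A ->
  dot v (A *m v) <= lambda_max A * dot v v.
Proof.
move=> sA; have [->|v0] := eqVneq v 0; first by rewrite mulmx0 !dot0r mulr0.
have sNA : (- A)^T = - A by rewrite linearN /= sA.
have [m mA mlb] := rayleigh_min sNA v0.
have mub w : dot w (A *m w) <= - m * dot w w.
  by have := mlb w; rewrite mulNmx dotNr; lra.
apply: le_trans (mub v) _; apply: ler_wpM2r; first exact: dot_ge0.
apply: ub_le_sup; last first.
  have /eigenvalueP[w wA w0] := mA; apply/eigenvalueP; exists w => //.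
  by rewrite scaleNr -wA mulmxN opprK.
exists (- m) => a /= /eigenvalue_form/(_ sA)[w w0 wa].
by rewrite -(@ler_pM2r _ (dot w w)) ?dot_gt0// -wa.
Qed.

End dot_product.

(** * Forms and the maximum norm *)

Section max_norm.
Context {R : realType} {d : nat}.
Implicit Types (u v w : 'cV[R]_d) (a : R).

Lemma cV_norm_leP v a : 0 <= a ->
  reflect (forall i, `|v i ord0| <= a) (`|v| <= a).
Proof.
move=> a0; rewrite [X in X <= _]/Num.Def.normr /= mx_normrE.
apply: (iffP (bigmax_leP _ _ _ _)) => [[_ h] i|h]; first exact: (h (i, ord0)).
by split=> // -[i j] _ /=; rewrite ord1.
Qed.

Lemma cV_coord_norm v i : `|v i ord0| <= `|v|.
Proof. by move: i; apply/cV_norm_leP. Qed.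

Definition cube (w : 'cV[R]_d) (r : R) : set 'cV[R]_d :=
  [set theta | `|theta - w| <= r].

Lemma cV_norm_tr v : `|v^T| = `|v|.
Proof.
rewrite !/Num.Def.normr /= !mx_normrE (reindex (fun k : 'I_d * 'I_1 => (k.2, k.1))) /=.
  by apply: eq_bigr => -[i j] _ /=; rewrite mxE.
by exists (fun k : 'I_1 * 'I_d => (k.2, k.1)) => -[i j].
Qed.

Lemma norm_dot_le u v : `|dot u v| <= d%:R * (`|u| * `|v|).
Proof.
rewrite dotE; apply: le_trans (ler_norm_sum _ _ _) _.
rewrite mulr_natl -[X in _ *+ X]card_ord -sumr_const; apply: ler_sum => i _.
by rewrite normrM ler_pM// cV_coord_norm.
Qed.

Lemma sqr_norm_le_dot u : `|u| ^+ 2 <= dot u u.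
Proof.
rewrite -[leRHS]sqr_sqrtr ?dot_ge0// lerXn2r ?nnegrE ?sqrtr_ge0//.
apply/cV_norm_leP => [|i]; first exact: sqrtr_ge0.
rewrite -sqrtr_sqr ler_wsqrtr// dotE (bigD1 i)//= -expr2 lerDl.
by apply: sumr_ge0 => j _; rewrite -expr2 sqr_ge0.
Qed.

(** The difference of the two forms is
[(beta - 2 t) theta' A u - 2 theta' A (theta - t u)]. The first term is at least
[3/2 t^2 lam]; by Cauchy-Schwarz the second one is at most [5/8 t^2 lam],
since [d kappa + 1] bounds the condition number of A for the maximum norm. The
radius is chosen so that its product with this bound is [t / 4]. *)
Lemma form_gap (A : 'M[R]_d) (u theta : 'cV[R]_d) (lam kappa beta t : R) :
  A^T = A -> 0 < lam -> 0 < kappa -> 0 < t -> 4 * t <= beta -> `|u| = 1 ->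
  (forall v, lam * dot v v <= dot v (A *m v)) ->
  (forall v, dot v (A *m v) <= kappa * lam * dot v v) ->
  cube (t *: u) (t / (4 * (d%:R * kappa + 1))) theta ->
  lam * t ^+ 2 / 2 <=
    dot theta (A *m (beta *: u)) - 2 * dot theta (A *m theta).
Proof.
move=> sA lam0 kappa0 t0 tbeta u1 A_ge A_le theta_near.
move: theta_near; rewrite /cube /= => theta_near.
set K := d%:R * kappa + 1 in theta_near.
have K1 : 1 <= K by rewrite lerDr mulr_ge0// ltW.
have K0 : 0 < K by rewrite (lt_le_trans ltr01).
set eta := theta - t *: u in theta_near.
set r := t / (4 * K) in theta_near.
have r0 : 0 < r by rewrite divr_gt0// mulr_gt0.
have Kr : K * r = t / 4 by rewrite /r; field; rewrite gt_eqF.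
have rt : r <= t / 4 by rewrite -Kr ler_peMl// ltW.
have A_norm v : dot v (A *m v) <= K * lam * `|v| ^+ 2.
  apply: le_trans (A_le v) _.
  have := norm_dot_le v v; rewrite (ger0_norm (dot_ge0 v)) -expr2 => dv.
  apply: (@le_trans _ _ (kappa * lam * (d%:R * `|v| ^+ 2))).
    by rewrite ler_wpM2l// mulr_ge0 ?ltW.
  have : 0 <= lam * `|v| ^+ 2 by rewrite mulr_ge0 ?sqr_ge0// ltW.
  by rewrite /K; nra.
have A0 v : 0 <= dot v (A *m v).
  by apply: le_trans (A_ge v); rewrite mulr_ge0 ?dot_ge0 ?ltW.
have A_bil v w : `|dot v (A *m w)| <= K * lam * (`|v| * `|w|).
  have Klam : 0 <= K * lam by rewrite mulr_ge0 ?ltW.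
  rewrite -(@ler_pXn2r _ 2)// ?nnegrE ?(mulr_ge0 Klam) ?mulr_ge0//.
  rewrite real_normK ?num_real//.
  apply: le_trans (psd_cauchy_schwarz v w sA A0) _.
  have -> : (K * lam * (`|v| * `|w|)) ^+ 2 =
    (K * lam * `|v| ^+ 2) * (K * lam * `|w| ^+ 2) by ring.
  by rewrite ler_pM.
have thetaE : theta = t *: u + eta by rewrite /eta addrC subrK.
have theta_norm : `|theta| <= t + r.
  rewrite thetaE (le_trans (ler_normD _ _))// lerD//.
  by rewrite normrZ u1 mulr1 gtr0_norm.
have first_term : 3 / 4 * t * lam <= dot theta (A *m u).
  rewrite {1}thetaE dotDl dotZl.
  have lam_u : lam <= dot u (A *m u).
    apply: le_trans (A_ge u); rewrite ler_peMr ?(ltW lam0)//.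
    by apply: le_trans (sqr_norm_le_dot u); rewrite u1 expr1n.
  have : `|dot eta (A *m u)| <= K * lam * r.
    by apply: le_trans (A_bil _ _) _; rewrite u1 mulr1 ler_wpM2l// mulr_ge0 ?ltW.
  have -> : K * lam * r = lam * (t / 4) by rewrite -Kr; ring.
  by rewrite ler_norml => /andP[h _]; nra.
have second_term : dot theta (A *m eta) <= lam * (t / 4) * (5 / 4 * t).
  apply: le_trans (ler_norm _) _; apply: le_trans (A_bil _ _) _.
  have -> : lam * (t / 4) * (5 / 4 * t) = K * lam * (5 / 4 * t * r).
    by rewrite -Kr; ring.
  rewrite ler_wpM2l ?mulr_ge0 ?(ltW K0) ?(ltW lam0)//.
  by rewrite ler_pM// (le_trans theta_norm)//; lra.
rewrite [in X in _ <= _ - X]thetaE mulmxDr dotDr -!scalemxAr !dotZr.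
rewrite -thetaE.
have : (2 * t) * (3 / 4 * t * lam) <= (beta - 2 * t) * dot theta (A *m u).
  rewrite ler_pM//; first by rewrite mulr_ge0 ?ltW.
    by rewrite !mulr_ge0 ?ltW.
  by lra.
by move: second_term; nra.
Qed.

End max_norm.

(** * The logistic capital process *)

Section likelihood.
Context {R : realType} {d : nat}.
Implicit Types (theta : 'cV[R]_d) (p y : R) (xi : game_path R d).

(** From [e^(-z) >= 1 - z] one gets [e^z <= 1 / (1 - z)], which is at most the
quadratic polynomial for [z <= 1/2]. *)
Lemma expR_le_quadratic (z : R) : `|z| <= 1 / 2 -> expR z <= 1 + z + 2 * z ^+ 2.
Proof.
rewrite ler_norml => /andP[z1 z2].
have e0 := expR_gt0 z; have := expR_ge1Dx (- z); rewrite expRN => h.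
have {}h : expR z * (1 - z) <= 1 by rewrite -ler_pdivlMl// mulr1.
have : 1 <= (1 + z + 2 * z ^+ 2) * (1 - z).
  have -> : (1 + z + 2 * z ^+ 2) * (1 - z) = 1 + z ^+ 2 * (1 - 2 * z) by ring.
  by rewrite lerDl mulr_ge0 ?sqr_ge0//; lra.
move=> /(le_trans h); rewrite ler_pM2r//; lra.
Qed.

(** The normalizing factor is [e^(p y)] times the moment generating function at
y of the centred outcome, whose expectation vanishes and whose variance is
[p (1 - p)]; only the quadratic term survives. *)
Lemma normalizer_le p y : 0 < p < 1 -> `|y| <= 1 / 2 ->
  1 + p * (expR y - 1) <= expR (p * y + 2 * (p * (1 - p) * y ^+ 2)).
Proof.
move=> /andP[p0 p1] y12.
have -> : 1 + p * (expR y - 1) =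
    expR (p * y) * (p * expR ((1 - p) * y) + (1 - p) * expR (- (p * y))).
  have -> : expR y = expR (p * y) * expR ((1 - p) * y).
    by rewrite -expRD; congr expR; ring.
  have : expR (p * y) * expR (- (p * y)) = 1 by rewrite -expRD subrr expR0.
  by set a := expR (p * y); set b := expR (- _) => ab; ring: ab.
rewrite expRD ler_pM2l ?expR_gt0//; apply: le_trans (expR_ge1Dx _).
have q_le q : 0 <= q <= 1 -> `|q * y| <= 1 / 2.
  by move=> /andP[q0 q1]; rewrite normrM ger0_norm//; have := normr_ge0 y; nra.
have e1 : expR ((1 - p) * y) <= 1 + (1 - p) * y + 2 * ((1 - p) * y) ^+ 2.
  by apply: expR_le_quadratic; apply: q_le; lra.
have e2 : expR (- (p * y)) <= 1 + - (p * y) + 2 * (- (p * y)) ^+ 2.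
  by apply: expR_le_quadratic; rewrite normrN; apply: q_le; lra.
have q0 : 0 < 1 - p by lra.
have := lerD (ler_wpM2l (ltW p0) e1) (ler_wpM2l (ltW q0) e2).
by move=> /le_trans; apply; rewrite le_eqVlt; apply/orP; left; apply/eqP; ring.
Qed.

(** The likelihood ratio of one day's outcome under the forecast tilted by theta
against the announced forecast; z lists forecast, side information and
outcome. *)
Definition likelihood theta (z : R * 'cV[R]_d * bool) : R :=
  expR (z.2%:R * dot theta z.1.2) / (1 + z.1.1 * (expR (dot theta z.1.2) - 1)).

Definition history_capital theta (h : seq (R * 'cV[R]_d * bool)) : R :=
  \prod_(z <- h) likelihood theta z.

Lemma historyS xi n : history xi n.+1 =
  rcons (history xi n) (forecast xi n, side xi n, outcome xi n).
Proof. by rewrite /history mkseqS. Qed.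

Lemma history_capital_rcons theta h z :
  history_capital theta (rcons h z) = history_capital theta h * likelihood theta z.
Proof. by rewrite /history_capital -cats1 big_cat big_seq1. Qed.

Lemma logistic_capitalE theta xi n :
  logistic_capital theta xi n = history_capital theta (history xi n).
Proof.
rewrite /logistic_capital; elim: n => [|n IH].
  by rewrite !big_ord0 dot0r expR0 divr1 /history_capital big_nil.
rewrite historyS history_capital_rcons -IH !big_ord_recr /= dotDr expRD dotZr.
by rewrite /likelihood /= invfM; ring.
Qed.

Lemma normalizer_gt0 p y : 0 < p < 1 -> 0 < 1 + p * (expR y - 1).
Proof. by move=> /andP[p0 p1]; have := mulr_gt0 p0 (expR_gt0 y); lra. Qed.

Lemma likelihood_ge0 theta z : 0 < z.1.1 < 1 -> 0 <= likelihood theta z.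
Proof.
by move=> hz; rewrite divr_ge0 ?expR_ge0// ltW// normalizer_gt0.
Qed.

(** The term of day i of the exponent is [theta' c_i (x_i - p_i) - 2 Var], with Var
the variance of [theta' c_i x_i] under the forecast: centring comes from the
normalizer, and the variances add up to the form of V. *)
Lemma logistic_capital_lower theta xi n :
  (forall i, `|dot theta (side xi i)| <= 1 / 2) ->
  expR (dot theta (S_ xi n) - 2 * dot theta (V_ xi n *m theta)) <=
  logistic_capital theta xi n.
Proof.
move=> small; rewrite logistic_capitalE; elim: n => [|n IH] /=.
  by rewrite mul0mx !dot0r mulr0 subrr expR0 /history_capital big_nil.
rewrite historyS history_capital_rcons.
set p := forecast xi n; set c := side xi n; set x := outcome xi n.
set y := dot theta c.
have p01 : 0 < p < 1 by exact: forecast_itv.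
have -> : dot theta (S_ xi n + (x%:R - p) *: c) -
    2 * dot theta ((V_ xi n + p * (1 - p) *: (c *m c^T)) *m theta) =
    (dot theta (S_ xi n) - 2 * dot theta (V_ xi n *m theta)) +
    (x%:R * y - (p * y + 2 * (p * (1 - p) * y ^+ 2))).
  have cc : dot theta (c *m c^T *m theta) = y ^+ 2.
    rewrite -mulmxA /dot mulmxA mxE big_ord1 -/(dot theta c) -/(dot c theta).
    by rewrite (dotC c) -/y expr2.
  by rewrite mulmxDl !dotDr -scalemxAl !dotZr cc -/y; ring.
rewrite expRD ler_pM ?expR_ge0//.
rewrite expRB /likelihood /= ler_pM2l ?expR_gt0//.
by rewrite lef_pV2 ?posrE ?expR_gt0 ?normalizer_gt0// normalizer_le// small.
Qed.

Lemma V_sym xi n : (V_ xi n)^T = V_ xi n.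
Proof.
elim: n => [|n IH] /=; first by rewrite trmx0.
by rewrite linearD linearZ /= IH trmx_mul trmxK.
Qed.

End likelihood.

(** * Divergence on a fixed cube *)

Section limsup.
Context {R : realType}.
Implicit Types u : R^nat.

Lemma limn_esup_lty u : (limn_esup (fun n => (u n)%:E) < +oo)%E ->
  exists2 kappa : R, 0 < kappa & \forall n \near \oo, u n <= kappa.
Proof.
move=> /ereal_inf_lt[_ [V Voo <-] supV].
have [r rV] : exists r : R, (ereal_sup [set (u n)%:E | n in V] <= r%:E)%E.
  case: (ereal_sup _) supV => [r| //|] _; first by exists r.
  by exists 0; rewrite leNye.
exists (Num.max r 1); first by rewrite lt_max ltr01 orbT.
apply: filterS Voo => n Vn; rewrite le_max -lee_fin.
by apply/orP; left; apply: le_trans rV; apply: ereal_sup_ubound; exists n.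
Qed.

Lemma limn_esup_pinfty u :
  (forall a N, exists2 n, (N <= n)%N & a <= u n) ->
  limn_esup (fun n => (u n)%:E) = +oo%E.
Proof.
move=> u_large; apply/eqP; rewrite -leye_eq.
apply: le_ereal_inf_tmp => _ [V [N _ NV] <-]; rewrite leye_eq.
apply/eqP/eqyP => a a0; have [n Nn an] := u_large a N.
apply: (@le_trans _ _ (u n)%:E); first by rewrite lee_fin.
by apply: ereal_sup_ubound; exists n => //; exact: NV.
Qed.

End limsup.

Section divergence.
Context {R : realType} {d : nat}.
Implicit Types (theta : 'cV[R]_d) (xi : game_path R d).

Lemma not_cvg0_frequently (b : nat -> 'cV[R]_d) :
  ~ b n @[n --> \oo] --> (0 : 'cV[R]_d) ->
  exists2 eps : R, 0 < eps &
    forall N, exists2 n, (N <= n)%N & eps <= `|b n|.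
Proof.
move=> ncvg; apply: contrapT => hN; apply: ncvg.
apply/cvgr0Pnorm_lt => eps eps0.
apply: contrapT => nnear; apply: hN; exists eps => // N.
apply: contrapT => nN; apply: nnear; exists N => // n /= Nn.
by rewrite ltNge; apply/negP => h; apply: nN; exists n.
Qed.

(** Compactness of the cube [[-1, 1]^d], applied to the filter of tails of the days
in P; the sequence is transposed because [rV_compact] concerns
row vectors. *)
Lemma unit_cluster (P : nat -> Prop) (u : nat -> 'cV[R]_d) :
  (forall N, exists2 n, (N <= n)%N & P n) ->
  (forall n, P n -> `|u n| = 1) ->
  exists2 w, `|w| <= 1 & forall eps, 0 < eps ->
    forall N, exists2 n, (N <= n)%N & P n /\ `|w - u n| < eps.
Proof.
move=> P_inf u1.
pose G := within P (nbhs (\oo : set_system nat)).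
have GP : ProperFilter G.
  apply: Build_ProperFilter_ex => V [N _ NV].
  by have [n Nn Pn] := P_inf N; exists n; exact: NV.
pose B := [set v : 'rV[R]_d | forall i, `[(-1 : R), 1]%classic (v ord0 i)].
have cB : compact B.
  by apply: (@rV_compact _ _ (fun=> `[(-1 : R), 1]%classic)) => i; exact: segment_compact.
pose ut n : 'rV[R]_d := (u n)^T.
have GB : (ut @ G) B.
  exists 0%N => // n _ Pn i; rewrite /ut mxE /= in_itv /= -ler_norml.
  by rewrite -(u1 n Pn) cV_coord_norm.
have [w [Bw cw]] := cB (ut @ G) _ GB.
exists w^T.
  apply/cV_norm_leP => // i; rewrite mxE ler_norml.
  by have := Bw i; rewrite /= in_itv.
move=> eps eps0 N.
have GN : (ut @ G) [set v | exists2 n, (N <= n)%N & P n /\ v = ut n].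
  by exists N => // n Nn Pn; exists n.
have [v [[n Nn [Pn ->]]]] := cw _ _ GN (nbhsx_ballx w eps eps0).
rewrite mx_norm_ball /ball_ /= => wu; exists n => //; split=> //.
by rewrite -cV_norm_tr linearB /= trmxK.
Qed.

(** The bound on the ratio turns into [lambda_max <= kappa * lambda_min] once
[lambda_min] is positive; lam0 is any threshold that [lambda_min] passes. *)
Lemma regular_spectrum xi : regular_event xi ->
  exists2 kappa, 0 < kappa & forall lam0, \forall n \near \oo,
    exists2 lam, lam0 <= lam &
      (forall v, lam * dot v v <= dot v (V_ xi n *m v)) /\
      (forall v, dot v (V_ xi n *m v) <= kappa * lam * dot v v).
Proof.
move=> [lmin_oo /limn_esup_lty[kappa kappa0 ratio] _].
exists kappa => // lam0.
have l1 : \forall n \near \oo, lam0 <= lambda_min (V_ xi n) by move/cvgryPge : lmin_oo.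
have l2 : \forall n \near \oo, 1 <= lambda_min (V_ xi n) by move/cvgryPge : lmin_oo.
near=> n; exists (lambda_min (V_ xi n)); first by near: n.
split=> v; first by apply: lambda_min_form; exact: V_sym.
apply: le_trans (lambda_max_form v (V_sym xi n)) _.
apply: ler_wpM2r; first exact: dot_ge0.
rewrite -ler_pdivrMr; first by near: n.
by apply: lt_le_trans ltr01 _; near: n.
Unshelve. all: by end_near. Qed.

Lemma pd_unitmx (A : 'M[R]_d) (lam : R) : 0 < lam ->
  (forall v, lam * dot v v <= dot v (A *m v)) -> A \in unitmx.
Proof.
move=> lam0 A_ge; rewrite -unitmx_tr -row_free_unit -kermx_eq0.
apply/eqP/row_matrixP => i; rewrite row0.
have : row i (kermx A^T) *m A^T = 0 by rewrite -row_mul mulmx_ker row0.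
move: (row _ _) => w /(congr1 trmx); rewrite trmx_mul trmxK trmx0 => Aw.
apply: trmx_inj; rewrite trmx0; apply/eqP; apply: contraTT isT => w0.
have := A_ge w^T; rewrite Aw dot0r leNgt mulr_gt0//; exact: dot_gt0.
Qed.

(** On days where [b = V^-1 S] is away from 0, [form_gap] makes the capital large
for theta in a cube around [t b / |b|] whose radius r does not depend on the
day. If [b / |b|] is close to a cluster point w, that cube contains the cube of
radius [r / 2] around [t w]. *)
Lemma logistic_capital_diverges xi (rho : R) : 0 < rho ->
  regular_event xi -> ~ consistency_event xi ->
  exists w, exists2 r, 0 < r &
    (forall theta, cube w r theta -> `|theta| < rho) /\
    forall a N, exists2 n, (N <= n)%N &
      forall theta, cube w r theta -> a <= logistic_capital theta xi n.
Proof.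
move=> rho0 reg /not_cvg0_frequently[eps eps0 b_large].
pose b n := invmx (V_ xi n) *m S_ xi n.
have [_ _ [M [_ cM]]] := reg.
have [kappa kappa0 spec] := regular_spectrum reg.
pose D := d%:R * (`|M| + 1).
have D0 : 0 <= D by rewrite mulr_ge0 ?addr_ge0.
have c_le i : `|side xi i| <= `|M| + 1.
  by apply: (cM (`|M| + 1)); [rewrite (le_lt_trans (ler_norm _))// ltrDl|exists i].
(* The three bounds on t ensure 4 t <= |b|, positivity of the prior on the
   cube, and |theta' c_i| <= 1/2. *)
pose t := Num.min (eps / 4) (Num.min (rho / 4) (1 / (4 * (D + 1)))).
have t0 : 0 < t by rewrite !lt_min !divr_gt0// ?mulr_gt0//; lra.
have t_eps : 4 * t <= eps.
  have : t <= eps / 4 by rewrite ge_min lexx.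
  by lra.
have t_rho : 4 * t <= rho.
  have : t <= rho / 4 by rewrite !ge_min lexx orbT.
  by lra.
have t_D : 4 * t * D <= 1.
  have : t <= 1 / (4 * (D + 1)) by rewrite !ge_min lexx !orbT.
  by rewrite ler_pdivlMr; [nra|lra].
pose K := d%:R * kappa + 1.
have K1 : 1 <= K by rewrite lerDr mulr_ge0// ltW.
pose r := t / (4 * K).
have r0 : 0 < r by rewrite divr_gt0//; lra.
have r_t : r <= t / 4.
  rewrite /r invfM mulrA ler_piMr ?invf_le1//; lra.
pose u n := `|b n|^-1 *: b n.
have unit_u n : eps <= `|b n| -> `|u n| = 1.
  move=> bn; rewrite normrZ normfV normr_id mulVf// gt_eqF//.
  by rewrite (lt_le_trans eps0).
have [w w1 w_near] := unit_cluster b_large unit_u.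
have tw : `|t *: w| <= t by rewrite normrZ gtr0_norm// ler_piMr// ltW.
have near_tw theta : cube (t *: w) (r / 2) theta -> `|theta| <= 2 * t.
  move=> h; rewrite -[theta](subrK (t *: w)) (le_trans (ler_normD _ _))//.
  by apply: le_trans (lerD h tw) _; lra.
exists (t *: w), (r / 2); first by rewrite divr_gt0.
split=> [theta /near_tw h|a N]; first by rewrite (le_lt_trans h)//; lra.
have [N0 _ specN] := spec (Num.max 1 (2 * `|a| / t ^+ 2)).
(* Scaling by t turns this radius into the half r / 2 that is left of r. *)
have rt0 : 0 < r / (2 * t) by rewrite divr_gt0// mulr_gt0.
have [n] := w_near _ rt0 (maxn N N0).
rewrite geq_max => /andP[Nn N0n] [bn wu]; exists n => // theta theta_w.
have [lam] := specN n N0n; rewrite ge_max => /andP[lam1 lam_a] [V_ge V_le].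
have lam0 : 0 < lam by rewrite (lt_le_trans ltr01).
have theta_le := near_tw _ theta_w.
have small i : `|dot theta (side xi i)| <= 1 / 2.
  apply: le_trans (norm_dot_le _ _) _.
  have : `|theta| * `|side xi i| <= 2 * t * (`|M| + 1) by rewrite ler_pM.
  move=> /(ler_wpM2l (ler0n R d)) /le_trans; apply.
  by move: t_D; rewrite /D; lra.
apply: le_trans (logistic_capital_lower n small).
have SE : S_ xi n = V_ xi n *m (`|b n| *: u n).
  rewrite /u scalerA mulfV ?scale1r; last by rewrite gt_eqF// (lt_le_trans eps0).
  by rewrite mulmxA mulmxV ?mul1mx// (pd_unitmx lam0).
apply: le_trans (ler_norm _) _.
apply: (@le_trans _ _ (lam * t ^+ 2 / 2)).
  by move: lam_a; rewrite ler_pdivrMr ?exprn_gt0//; lra.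
apply: (@le_trans _ _ (dot theta (S_ xi n) - 2 * dot theta (V_ xi n *m theta))).
  rewrite SE; apply: (@form_gap _ _ _ _ _ _ kappa) => //.
  - exact: V_sym.
  - exact: le_trans bn.
  - exact: unit_u.
  rewrite -/K -/r /cube /= -[theta](subrK (t *: w)) -addrA -scalerBr.
  apply: le_trans (ler_normD _ _) _.
  rewrite [leRHS]splitr lerD// normrZ gtr0_norm// -ler_pdivlMl//.
  have -> : t^-1 * (r / 2) = r / (2 * t) by field; rewrite gt_eqF.
  exact: ltW.
by apply: le_trans (expR_ge1Dx _); rewrite lerDr.
Qed.

End divergence.

(** * Mixtures over the prior *)

Section mixture.
Context {R : realType} {d : nat}.
Implicit Types (theta : 'cV[R]_d) (xi : game_path R d).
Implicit Types (z : R * 'cV[R]_d * bool) (h : seq (R * 'cV[R]_d * bool)).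

Definition valid_history h := {in h, forall z, 0 < z.1.1 < 1}.

Lemma valid_history_path xi n : valid_history (history xi n).
Proof. by move=> _ /mapP[i _ ->]; exact: forecast_itv. Qed.

Lemma valid_history_rcons h z :
  valid_history h -> 0 < z.1.1 < 1 -> valid_history (rcons h z).
Proof.
by move=> hh hz y; rewrite mem_rcons inE => /orP[/eqP ->//|]; exact: hh.
Qed.

Lemma measurable_dot (c : 'cV[R]_d) : measurable_fun setT (fun theta => dot theta c).
Proof.
under eq_fun do rewrite dotE.
apply: measurable_sum => i; apply: measurable_funM => //.
exact: measurable_cV_coord.
Qed.

(** The quotient is written as an exponential, because ln is a measurable function
and the normalizer is positive. *)
Lemma measurable_likelihood z : 0 < z.1.1 < 1 ->
  measurable_fun setT (fun theta => likelihood theta z).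
Proof.
move=> z01.
rewrite (_ : (fun _ => _) = fun theta => expR (z.2%:R * dot theta z.1.2 -
    ln (1 + z.1.1 * (expR (dot theta z.1.2) - 1)))); last first.
  apply/funext => theta; rewrite /likelihood expRB lnK//.
  by rewrite posrE normalizer_gt0.
apply: measurableT_comp => //; apply: measurable_funB.
  by apply: measurable_funM => //; exact: measurable_dot.
apply: measurableT_comp; first exact: measurable_ln.
apply: measurable_funD => //; apply: measurable_funM => //.
apply: measurable_funB => //; apply: measurableT_comp => //.
exact: measurable_dot.
Qed.

Lemma measurable_history_capital h : valid_history h ->
  measurable_fun setT (fun theta => history_capital theta h).
Proof.
by move=> hh; apply: measurable_prod => z zh; apply: measurable_likelihood; exact: hh.
Qed.

Lemma history_capital_ge0 theta h : valid_history h -> 0 <= history_capital theta h.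
Proof.
move=> hh; rewrite /history_capital big_seq; apply: prodr_ge0 => z zh.
by apply: likelihood_ge0; exact: hh.
Qed.

(** Under the forecast p the likelihood ratio has mean 1. As the two terms are
nonnegative, this also bounds each of them. *)
Lemma likelihood_fair theta p c : 0 < p < 1 ->
  p * likelihood theta (p, c, true) + (1 - p) * likelihood theta (p, c, false) = 1.
Proof.
move=> p01; rewrite /likelihood /= mul1r mul0r expR0.
by field; rewrite gt_eqF// normalizer_gt0.
Qed.

Lemma likelihood_bounded z : 0 < z.1.1 < 1 ->
  exists2 C : R, 0 <= C & forall theta, likelihood theta z <= C.
Proof.
move: z => [[p c] x] /= p01; have /andP[p0 p1] := p01.
have q0 : 0 < 1 - p by lra.
exists (p^-1 + (1 - p)^-1); first by rewrite addr_ge0// invr_ge0 ltW.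
move=> theta; have fair := likelihood_fair theta c p01.
have l1 := @likelihood_ge0 _ _ theta (p, c, true) p01.
have l0 := @likelihood_ge0 _ _ theta (p, c, false) p01.
have p'0 : 0 < p^-1 by rewrite invr_gt0.
have q'0 : 0 < (1 - p)^-1 by rewrite invr_gt0.
case: x.
  by apply: (@le_trans _ _ p^-1); [rewrite -[leRHS]mulr1 ler_pdivlMl//; nra|lra].
by apply: (@le_trans _ _ (1 - p)^-1); [rewrite -[leRHS]mulr1 ler_pdivlMl//; nra|lra].
Qed.

Lemma history_capital_bounded h : valid_history h ->
  exists2 C : R, 0 <= C & forall theta, history_capital theta h <= C.
Proof.
elim/last_ind: h => [_|h z IH hz].
  by exists 1 => // theta; rewrite /history_capital big_nil.
have hh : valid_history h by move=> y yh; apply: hz; rewrite mem_rcons inE yh orbT.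
have z01 : 0 < z.1.1 < 1 by apply: hz; rewrite mem_rcons mem_head.
have [C C0 hC] := IH hh; have [D D0 zD] := likelihood_bounded z01.
exists (C * D) => [|theta]; first exact: mulr_ge0.
rewrite history_capital_rcons ler_pM//; first exact: history_capital_ge0.
exact: likelihood_ge0.
Qed.

Context (prior : 'cV[R]_d -> R) (hprior : prior_density prior).

(** The Bayesian capital as a function of the history alone, so that it can be
evaluated at both possible continuations of a history. *)
Definition mixture h : \bar R :=
  (\int[lebesgue_cV d]_theta (history_capital theta h * prior theta)%:E)%E.

Lemma bayesian_capitalE xi n :
  bayesian_capital prior xi n = mixture (history xi n).
Proof.
by apply: eq_integral => theta _; rewrite logistic_capitalE.
Qed.

Let prior_ge0 theta : 0 <= prior theta. Proof. by case: hprior. Qed.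

Let measurable_prior : measurable_fun setT prior. Proof. by case: hprior. Qed.

Let measurable_integrand h : valid_history h ->
  measurable_fun setT (fun theta => (history_capital theta h * prior theta)%:E).
Proof.
move=> hh; apply/measurable_EFinP; apply: measurable_funM => //.
exact: measurable_history_capital.
Qed.

Let integrand_ge0 h theta : valid_history h ->
  (0 <= (history_capital theta h * prior theta)%:E)%E.
Proof. by move=> hh; rewrite lee_fin mulr_ge0// history_capital_ge0. Qed.

Lemma mixture_ge0 h : valid_history h -> (0 <= mixture h)%E.
Proof. by move=> hh; apply: integral_ge0 => theta _; exact: integrand_ge0. Qed.

Lemma mixture_fin_num h : valid_history h -> mixture h \is a fin_num.
Proof.
move=> hh; rewrite ge0_fin_numE ?mixture_ge0//.
have [C C0 hC] := history_capital_bounded hh.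
apply: (@le_lt_trans _ _ (\int[lebesgue_cV d]_theta (C%:E * (prior theta)%:E))%E).
  apply: ge0_le_integral => //=.
  - by move=> theta _; exact: integrand_ge0.
  - exact: measurable_integrand.
  - by apply: measurable_funeM; apply/measurable_EFinP.
  - by move=> theta _; rewrite -EFinM lee_fin ler_wpM2r.
rewrite ge0_integralZl//.
- by case: hprior => _ _ ->; rewrite mule1 ltry.
- exact/measurable_EFinP.
- by move=> theta _; rewrite lee_fin.
Qed.

(** The integral over the prior of [likelihood_fair], multiplied by the capital
before the bet. *)
Lemma mixture_fair h p c : valid_history h -> 0 < p < 1 ->
  fine (mixture h) = p * fine (mixture (rcons h (p, c, true))) +
    (1 - p) * fine (mixture (rcons h (p, c, false))).
Proof.
move=> hh p01; have /andP[p0 p1] := p01.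
have hr x : valid_history (rcons h (p, c, x)) by exact: valid_history_rcons.
apply: EFin_inj; rewrite EFinD !EFinM !fineK; try exact: mixture_fin_num.
have q0 : 0 <= 1 - p by lra.
have mix_scale a x : 0 <= a -> (a%:E * mixture (rcons h (p, c, x)) =
    \int[lebesgue_cV d]_theta
      (a%:E * (history_capital theta (rcons h (p, c, x)) * prior theta)%:E))%E.
  move=> a0; rewrite ge0_integralZl//.
  - exact: measurable_integrand.
  - by move=> theta _; exact: integrand_ge0.
rewrite !mix_scale// -?ge0_integralD//; try exact: ltW.
- apply: eq_integral => theta _; rewrite -!EFinM -EFinD; congr EFin.
  rewrite !history_capital_rcons -[LHS]mul1r -[in LHS](likelihood_fair theta c p01).
  by ring.
- by move=> theta _; rewrite mule_ge0 ?integrand_ge0// lee_fin ltW.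
- by apply: measurable_funeM; exact: measurable_integrand.
- by move=> theta _; rewrite mule_ge0 ?integrand_ge0.
- by apply: measurable_funeM; exact: measurable_integrand.
Qed.

(** [x - p] differs by 1 between the two outcomes, so the bet has to be the
difference of the two possible capitals. *)
Definition bayesian_strategy : strategy R d := fun h p c =>
  fine (mixture (rcons h (p, c, true))) - fine (mixture (rcons h (p, c, false))).

Lemma mixture_nil : mixture [::] = 1%E.
Proof.
case: hprior => _ _ <-; apply: eq_integral => theta _.
by rewrite /history_capital big_nil mul1r.
Qed.

Lemma bayesian_strategyP : is_bayesian_logistic prior bayesian_strategy.
Proof.
move=> xi n; rewrite bayesian_capitalE.
rewrite -[RHS]fineK ?mixture_fin_num//; last exact: valid_history_path.
congr EFin; elim: n => [|n IH] /=; first by rewrite mixture_nil.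
have p01 := forecast_itv xi n.
rewrite IH historyS (mixture_fair (side xi n) (@valid_history_path xi n) p01).
by rewrite /bet /bayesian_strategy; case: (outcome xi n) => /=; ring.
Qed.

(** A cube for the maximum norm is a product of intervals of length [2 r]. *)
Lemma cube_pos_measure (w : 'cV[R]_d) (r : R) : 0 < r ->
  measurable (cube w r) /\ (0 < lebesgue_cV d (cube w r))%E.
Proof.
move=> r0.
pose A (i : 'I_d) : set (measurableTypeR R) := `[w i ord0 - r, w i ord0 + r]%classic.
have mA i : measurable (A i) by exact: measurable_itv.
have -> : cube w r = [set v : 'cV[R]_d | forall i, A i (v i ord0)].
  apply/seteqP; split=> theta /=.
    move=> h i; have := cV_coord_norm (theta - w) i => /le_trans/(_ h).
    by rewrite !mxE /A /= in_itv /= ler_distl.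
  move=> h; apply/cV_norm_leP; first exact: ltW.
  by move=> i; rewrite !mxE ler_distl; have := h i; rewrite /A /= in_itv.
split.
  rewrite (_ : [set _ | _] = \bigcap_(i in [set: 'I_d]) (setT `&` cV_coord i @^-1` A i)).
    by apply: fin_bigcap_measurable => // i _; exact: measurable_cV_coord.
  by apply/seteqP; split=> [v h i _|v h i]; [split=> //; exact: h|have [] := h i I].
rewrite lebesgue_cV_box//.
elim/big_ind : _ => // [x y|i _]; first exact: mule_gt0.
rewrite lebesgue_measure_itv/= lte_fin ifT; last by lra.
by rewrite -EFinB lte_fin; lra.
Qed.

(** If the integral were zero, the prior would vanish almost everywhere on the
cube, which has positive measure. *)
Lemma prior_mass_gt0 (w : 'cV[R]_d) (r : R) : 0 < r ->
  (forall theta, cube w r theta -> 0 < prior theta) ->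
  (0 < \int[lebesgue_cV d]_(theta in cube w r) (prior theta)%:E)%E.
Proof.
move=> r0 prior_gt0; have [mB B0] := cube_pos_measure w r0.
set B := cube w r in mB B0 prior_gt0 *.
have mprior : measurable_fun B (EFin \o prior).
  by apply/measurable_EFinP; exact: measurable_funTS.
rewrite lt_neqAle integral_ge0 ?andbT; last by move=> *; rewrite lee_fin.
apply/eqP => int0; have /(ae_eq_integral_abs _ mB mprior) : (\int[lebesgue_cV d]_(theta in B)
    `|(EFin \o prior) theta| = 0)%E.
  rewrite int0; apply: eq_integral => theta _ /=.
  by rewrite ger0_norm.
move=> [N [mN N0 BN]]; move: B0; rewrite lt_neqAle => /andP[/eqP + _]; apply.
apply/esym; apply: (subset_measure0 mB mN) => // theta Btheta; apply: BN => /= h.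
by have := h Btheta => /= -[] /eqP; rewrite gt_eqF// prior_gt0.
Qed.

Lemma mixture_ge_on_cube h (w : 'cV[R]_d) (r a : R) : valid_history h ->
  0 < r -> 0 <= a ->
  (forall theta, cube w r theta -> a <= history_capital theta h) ->
  (a%:E * \int[lebesgue_cV d]_(theta in cube w r) (prior theta)%:E <= mixture h)%E.
Proof.
move=> hh r0 a0 a_le; have [mB _] := cube_pos_measure w r0.
rewrite -ge0_integralZl//; last 2 first.
- by apply/measurable_EFinP; exact: measurable_funTS.
- by move=> theta _; rewrite lee_fin.
apply: (@le_trans _ _ (\int[lebesgue_cV d]_(theta in cube w r)
    (history_capital theta h * prior theta)%:E)%E).
  apply: ge0_le_integral => //.
  - by move=> theta _; rewrite -EFinM lee_fin mulr_ge0.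
  - apply: measurable_funeM; apply/measurable_EFinP; exact: measurable_funTS.
  - by apply: measurable_funTS; exact: measurable_integrand.
  - by move=> theta Btheta; rewrite -EFinM lee_fin ler_wpM2r// a_le.
apply: ge0_subset_integral => //; first exact: measurable_integrand.
by move=> theta _; exact: integrand_ge0.
Qed.

End mixture.

(** * Weak forcing *)

Theorem theorem4p1 (R : realType) (d : nat) (hd : (1 <= d)%N)
    (prior : 'cV[R]_d -> R) (hprior : prior_density prior)
    (hsupp : supports_nbhs_origin prior) :
  exists2 P : strategy R d,
    is_bayesian_logistic prior P &
    weakly_forces P regular_event consistency_event.
Proof.
have bayesP := bayesian_strategyP hprior.
exists (bayesian_strategy prior) => //; split=> [xi n|xi [reg ncons]].
  rewrite -lee_fin bayesP bayesian_capitalE; apply: mixture_ge0 => //.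
  exact: valid_history_path.
have /nbhs_ballP[rho /= rho0 prior_gt0] := hsupp.
have [w [r r0 [w_rho diverges]]] := logistic_capital_diverges rho0 reg ncons.
have prior_cube theta : cube w r theta -> 0 < prior theta.
  move=> /w_rho h; apply: prior_gt0.
  by rewrite mx_norm_ball /ball_ /= sub0r normrN.
have [m m0 m_mass] : exists2 m : R, 0 < m &
    (m%:E <= \int[lebesgue_cV d]_(theta in cube w r) (prior theta)%:E)%E.
  move: (prior_mass_gt0 hprior r0 prior_cube).
  case: (integral _ _ _) => [m m0| _|//]; first by exists m.
  by exists 1; rewrite ?leey.
apply: limn_esup_pinfty => a N.
have [n Nn a_le] := diverges (`|a| / m) N; exists n => //.
have am0 : 0 <= `|a| / m by rewrite divr_ge0// ltW.
apply: (le_trans (ler_norm a)).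
rewrite -(divfK (lt0r_neq0 m0) `|a|) -lee_fin bayesP bayesian_capitalE EFinM.
apply: (@le_trans _ _ ((`|a| / m)%:E *
    \int[lebesgue_cV d]_(theta in cube w r) (prior theta)%:E)%E).
  by apply: lee_wpmul2l; rewrite // lee_fin.
apply: mixture_ge_on_cube => //; first exact: valid_history_path.
by move=> theta /a_le; rewrite logistic_capitalE.
Qed.
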